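(* Let $n\ge 3$ and let $G=([n],\omega)$ be a consistently oriented cycle graph with shortest path function $d$. For every $\delta$ with $$\max_{i}\ \omega(i,i+1 \ (\mathrm{mod}\ n))\ \le\ \delta\ <\ \min_{i\neq j}\ \max\{d(i,j),d(j,i)\},$$ there exists a nontrivial class in the first homology group of $\mathfrak{D}_\delta(G)$, i.e. $H_1(\mathfrak{D}_\delta(G))\neq 0$.
   Context: A network $G=(X,\omega)$ is a finite vertex set $X$ with $\omega:X\times X\to[0,\infty]$. The weight of a path $(x_0,\dots,x_m)$ is $\sum_i\omega(x_i,x_{i+1})$ ($0$ for a constant path), $d(x,y)$ is the infimum of the weights of paths from $x$ to $y$, and $P(G)=(X,d)$ is the path completion. For finite real $\delta\ge0$, $\mathfrak{D}_\delta(G)$ is the simplicial complex on $X$ whose simplices are the nonempty $\sigma\subseteq X$ for which there is $y\in X$ with $d(y,x)\le\delta$ for all $x\in\sigma$ (Dowker source complex of the path completion). A consistently oriented cycle graph is a network on $[n]=\{1,\dots,n\}=\mathbb{Z}/n\mathbb{Z}$ such that for distinct $i,j$, $\omega(i,j)<\infty$ if and only if $j=i+1\pmod n$. Homology has real coefficients. *)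

(* Defs.v *)
From HB Require Import structures.
From mathcomp Require Import all_boot all_order all_algebra ring_quotient.
From mathcomp Require Import all_classical all_reals all_analysis.

Set Implicit Arguments.
Unset Strict Implicit.
Unset Printing Implicit Defensive.

Import Order.TTheory GRing.Theory Num.Theory.
Local Open Scope ring_scope.

Section SimplicialHomology.
Variable X : finType.

(* A vertex of [X] need not be a simplex, and the empty set never is one. *)
Record simplicial_complex := SimplicialComplex {
  simplices :> {set {set X}};
  simplices_neq0 : forall s, s \in simplices -> s != finset.set0;
  simplices_sub : forall s t : {set X},
    s \in simplices -> t \subset s -> t != finset.set0 -> t \in simplices
}.

Variables (F : fieldType) (K : simplicial_complex).

Definition simplex (k : nat) := {s : {set X} | (s \in K) && (#|s| == k.+1)}.

(* The [k]-simplex [s] stands for the generator oriented by listing its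
   vertices in the order of [enum X]. *)
Definition chain (k : nat) := {ffun simplex k -> F^o}.

(* Coefficients of the usual formula
   [v_0, ..., v_k] |-> \sum_i (-1)^i [v_0, ..., v_i omitted, ..., v_k];
   [index v (enum s)] is the position of the vertex [v] in [s]. *)
Definition boundary_fun (k : nat) (c : chain k.+1) : chain k :=
  [ffun t : simplex k => \sum_(s : simplex k.+1)
     \sum_(v in val s | val t == val s :\ v)
        (-1) ^+ index v (enum (val s)) * c s].

Lemma boundary_fun_is_linear (k : nat) : linear (@boundary_fun k).
Proof.
move=> a c1 c2; apply/ffunP => t; rewrite !ffunE scaler_sumr -big_split /=.
apply: eq_bigr => s _; rewrite scaler_sumr -big_split /=.
by apply: eq_bigr => v _; rewrite !ffunE mulrDr /GRing.scale /= mulrCA.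
Qed.

HB.instance Definition _ (k : nat) :=
  GRing.isLinear.Build F (chain k.+1) (chain k) _ (@boundary_fun k)
    (@boundary_fun_is_linear k).

Definition boundary (k : nat) : 'Hom(chain k.+1, chain k) :=
  linfun (@boundary_fun k).

Definition cycles (k : nat) : {vspace chain k} :=
  match k with
  | 0 => fullv
  | k'.+1 => lker (boundary k')
  end.

Definition boundaries (k : nat) : {vspace subvs_of (cycles k)} :=
  (linfun vsval @^-1: limg (boundary k))%VS.

(* The quotient is taken in abelian groups: its scalar action is not recorded. *)
Definition homology (k : nat) : zmodType :=
  {ideal_quot (pred_of_vspace (boundaries k))}.

End SimplicialHomology.

Section Networks.
Variables (R : realType) (X : finType).
Local Open Scope ereal_scope.

Record network := Network {
  weight :> X -> X -> \bar R;
  weight_ge0 : forall x y, 0 <= weight x y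
}.

(* The path (x, p_0, ..., p_(m-1)) is given by [x] and [p]. *)
Definition path_weight (G : network) (x : X) (p : seq X) : \bar R :=
  \sum_(i < size p) G (nth x (x :: p) i) (nth x (x :: p) i.+1).

Definition path_dist (G : network) (x y : X) : \bar R :=
  ereal_inf [set path_weight G x p | p in [set p | last x p = y]]%classic.

Lemma path_dist_ge0 (G : network) (x y : X) : 0 <= path_dist G x y.
Proof.
apply: le_ereal_inf_tmp => _ [p _ <-].
by apply: sume_ge0 => i _; apply: weight_ge0.
Qed.

Definition path_completion (G : network) : network :=
  Network (path_dist_ge0 G).

Definition dowker_source_simplices (G : network) (delta : R) : {set {set X}} :=
  [set s : {set X} |
    (s != finset.set0) && [exists y, [forall (x | x \in s), G y x <= delta%:E]]].

Lemma dowker_source_neq0 (G : network) (delta : R) (s : {set X}) :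
  s \in dowker_source_simplices G delta -> s != finset.set0.
Proof. by rewrite inE => /andP[]. Qed.

Lemma dowker_source_sub (G : network) (delta : R) (s t : {set X}) :
  s \in dowker_source_simplices G delta -> t \subset s -> t != finset.set0 ->
  t \in dowker_source_simplices G delta.
Proof.
rewrite !inE => /andP[_ /existsP[y /forall_inP Hy]] /fintype.subsetP ts ->.
by apply/existsP; exists y; apply/forall_inP => x /ts /Hy.
Qed.

Definition dowker_source (G : network) (delta : R) : simplicial_complex X :=
  SimplicialComplex (@dowker_source_neq0 G delta) (@dowker_source_sub G delta).

Definition path_dowker (G : network) (delta : R) : simplicial_complex X :=
  dowker_source (path_completion G) delta.

End Networks.

(* [ordS] is the successor modulo [n]. *)
Definition consistently_oriented_cycle (R : realType) (n : nat)
    (G : network R 'I_n) : Prop :=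
  forall i j : 'I_n, i != j -> ((G i j < +oo)%E <-> j = ordS i).

(* Main.v *)
Require Import Defs.
From mathcomp Require Import all_boot all_order all_algebra.
From mathcomp Require Import all_classical all_reals all_analysis.
From mathcomp Require Import ring_quotient zify ring.

Set Implicit Arguments.
Unset Strict Implicit.
Unset Printing Implicit Defensive.

Import Order.TTheory GRing.Theory Num.Theory.
Local Open Scope ring_scope.

(** If [a] lies on the forward arc from [y] to [b], every finite path from [y]
    to [b] goes through [a], so [d a b <= d y b].  By the upper bound on [delta]
    at most one of [d a b], [d b a] is [<= delta], hence an edge [{a, b}] has a
    well-defined direction.  Let the cochain [winding] be [0] on an edge [a < b]
    directed from [a] to [b], and [-1] otherwise.  On the simplices contained in
    the forward ball of [y] it is the coboundary of the indicator of [x < y], so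
    it is a cocycle.  The lower bound on [delta] puts all edges [{i, i + 1}] in
    the complex, and [winding] takes the value [1] on the cycle they form. *)

(** * Detecting homology classes by pairing with cochains *)

Lemma homology_neq0 (X : finType) (F : fieldType) (K : simplicial_complex X)
    (k : nat) (phi : chain F K k.+1 -> F) (z : chain F K k.+1) :
    (forall c : chain F K k.+2, phi (boundary_fun c) = 0) ->
    boundary_fun z = 0 -> phi z != 0 ->
  exists c : homology F K k.+1, c != 0.
Proof.
move=> phi_coboundary dz phiz.
have zZ : z \in cycles F K k.+1 by rewrite memv_ker lfunE /= dz.
exists (\pi_(homology F K k.+1) (Subvs zZ))%qT.
apply/negP => /eqP z0.
(* The class of [z] is zero exactly when [z - 0] lies in the ideal of boundaries, and then [phi z]
   would vanish. *)
have : (Subvs zZ - 0 \in boundaries F K k.+1).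
  by rewrite Quotient.idealrBE; apply/eqP; rewrite z0 piE.
rewrite subr0 -memv_preim lfunE /= => /memv_imgP[c _].
rewrite lfunE /= => zc.
by move: phiz; rewrite zc phi_coboundary eqxx.
Qed.

(** Summation by parts: the coboundary is the transpose of the boundary. Taking [f] on all sets lets
    a face [val s :\ v] be its argument without a proof that it is a simplex. *)
Lemma sum_boundary (X : finType) (F : fieldType) (K : simplicial_complex X)
    (k : nat) (f : {set X} -> F) (c : chain F K k.+1) :
  \sum_(t : simplex K k) f (val t) * boundary_fun c t =
  \sum_(s : simplex K k.+1) c s *
    \sum_(v in val s) (-1) ^+ index v (enum (val s)) * f (val s :\ v).
Proof.
under eq_bigr => t _ do rewrite ffunE mulr_sumr.
rewrite exchange_big; apply: eq_bigr => s _.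
under eq_bigr => t _ do rewrite mulr_sumr.
rewrite (exchange_big_dep (fun v => v \in val s)) /=;
  last by move=> t v _ /andP[].
rewrite mulr_sumr; apply: eq_bigr => v vs.
have /andP[sK /eqP cards] := valP s.
have cardsv : #|val s :\ v| = k.+1.
  by move: cards; rewrite (cardsD1 v) vs add1n => -[].
have sv : (val s :\ v \in K) && (#|val s :\ v| == k.+1).
  rewrite cardsv eqxx andbT (simplices_sub sK) ?subD1set //.
  by rewrite -card_gt0 cardsv.
rewrite (big_pred1 (Sub (val s :\ v) sv : simplex K k)).
  by rewrite SubK; ring.
by move=> t; rewrite vs /= -val_eqE.
Qed.

(** * Boundary signs from increasing enumerations of ordinals *)

Lemma sorted_enum_ord (n : nat) (A : {set 'I_n}) :
  sorted (relpre val ltn) (enum A).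
Proof.
rewrite {1}/enum_mem; apply: sorted_filter.
  by move=> x y z /=; apply: ltn_trans.
by rewrite -enumT -sorted_map val_enum_ord iota_ltn_sorted.
Qed.

Lemma enum_set_ord (n : nat) (s : seq 'I_n) :
  sorted (relpre val ltn) s -> enum [set x in s] = s.
Proof.
move=> s_sorted; apply: (irr_sorted_eq (leT := relpre val ltn)) => //.
- by move=> x y z /=; apply: ltn_trans.
- by move=> x /=; apply: ltnn.
- exact: sorted_enum_ord.
- by move=> x; rewrite mem_enum inE.
Qed.

Section AlternatingSums.
Variables (n : nat) (F : fieldType) (f : {set 'I_n} -> F).

Lemma alternating_sum2 (a b : 'I_n) : (a < b)%N ->
  let A := [set a; b] in
  \sum_(v in A) (-1) ^+ index v (enum A) * f (A :\ v) = f [set b] - f [set a].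
Proof.
move=> ab A; have enumA : enum A = [:: a; b].
  rewrite -[RHS]enum_set_ord /= ?ab //.
  by apply: eq_enum => x; rewrite !inE.
have neq : a != b by rewrite -val_eqE /= neq_ltn ab.
rewrite -big_enum enumA !big_cons big_nil /= !eqxx (negPf neq).
rewrite expr0 expr1 mul1r mulN1r addr0.
congr (f _ - f _); apply/setP => x; rewrite !inE.
  by case: eqVneq => //= ->; rewrite (negPf neq).
by rewrite orbC; case: eqVneq => //= ->; rewrite eq_sym (negPf neq).
Qed.

Lemma alternating_sum3 (a b c : 'I_n) : (a < b)%N -> (b < c)%N ->
  let A := [set a; b; c] in
  \sum_(v in A) (-1) ^+ index v (enum A) * f (A :\ v) =
  f [set b; c] - f [set a; c] + f [set a; b].
Proof.
move=> ab bc A; have enumA : enum A = [:: a; b; c].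
  rewrite -[RHS]enum_set_ord /= ?ab ?bc //.
  by apply: eq_enum => x; rewrite !inE orbA.
have neq_ab : a != b by rewrite -val_eqE /= neq_ltn ab.
have neq_bc : b != c by rewrite -val_eqE /= neq_ltn bc.
have neq_ac : a != c by rewrite -val_eqE /= neq_ltn (ltn_trans ab bc).
rewrite -big_enum enumA !big_cons big_nil /= !eqxx.
rewrite (negPf neq_ab) (negPf neq_bc) (negPf neq_ac).
rewrite expr0 expr1 sqrrN expr1n !mul1r mulN1r addr0 addrA.
congr (f _ - f _ + f _); apply/setP => x; rewrite !inE.
- by case: eqVneq => //= ->; rewrite (negPf neq_ab) (negPf neq_ac).
- case: (eqVneq x b) => [->|] /=; last by rewrite orbF.
  by rewrite eq_sym (negPf neq_ab) (negPf neq_bc).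
- case: (eqVneq x c) => [->|] /=; last by rewrite orbF.
  by rewrite ![c == _]eq_sym (negPf neq_bc) (negPf neq_ac).
Qed.

End AlternatingSums.

Lemma set_ord_card3 (n : nat) (A : {set 'I_n}) : #|A| = 3 ->
  exists a b c : 'I_n, [/\ (a < b)%N, (b < c)%N & A = [set a; b; c]].
Proof.
have := sorted_enum_ord A; have memA := mem_enum A.
rewrite cardE; case: (enum A) memA => [|a [|b [|c [|? ?]]]] //= memA.
case/and3P=> ab bc _ _; exists a, b, c; split=> //.
by apply/setP => x; rewrite -memA !inE orbA.
Qed.

(** * Cyclic successor and path distances *)

Lemma ordS_val (n : nat) (i : 'I_n) :
  (nat_of_ord (ordS i) = i.+1 /\ (i.+1 < n)%N) \/
  (nat_of_ord (ordS i) = 0%N /\ i.+1 = n).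
Proof.
rewrite /=; have := ltn_ord i; rewrite leq_eqVlt => /orP[/eqP ->|lt_n].
  by right; rewrite modnn.
by left; rewrite modn_small.
Qed.

Lemma neq_ordS (n : nat) (i : 'I_n) : (1 < n)%N -> i != ordS i.
Proof.
move=> n_gt1; apply/eqP => /(congr1 (@nat_of_ord n)).
by case: (ordS_val i) => -[-> ?]; lia.
Qed.

Section PathDistance.
Variables (R : realType) (n : nat) (G : network R 'I_n).
Local Open Scope ereal_scope.

Lemma path_weight_cons (x z : 'I_n) (p : seq 'I_n) :
  path_weight G x (z :: p) = G x z + path_weight G z p.
Proof.
rewrite /path_weight /= big_ord_recl /=; congr (_ + _).
apply: eq_bigr => i _ /=; congr (G _ _); apply: set_nth_default => //=.
  by rewrite add0n ltnS ltnW.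
by rewrite add0n.
Qed.

Lemma path_weight_ge0 (x : 'I_n) (p : seq 'I_n) : 0 <= path_weight G x p.
Proof. by apply: sume_ge0 => i _; apply: weight_ge0. Qed.

Lemma path_dist_le (x : 'I_n) (p : seq 'I_n) :
  path_dist G x (last x p) <= path_weight G x p.
Proof. by apply: ereal_inf_lbound; exists p. Qed.

Lemma path_dist_weight (x y : 'I_n) : path_dist G x y <= G x y.
Proof.
have := path_dist_le x [:: y].
by rewrite path_weight_cons /path_weight /= big_ord0 adde0.
Qed.

(** The number of [ordS] steps from [y] to [x]: comparing ranks gives the order in which the forward
    walk from [y] meets the vertices. *)
Definition cyclic_rank (y x : 'I_n) : nat :=
  if (y <= x)%N then (x - y)%N else (x + n - y)%N.

(** Induction on the path: until [a] is reached, dropping the first edge preserves the comparison of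
    ranks, and it cannot increase the weight. *)
Lemma path_dist_arc (y a b : 'I_n) : consistently_oriented_cycle G ->
  (cyclic_rank y a <= cyclic_rank y b)%N ->
  path_dist G a b <= path_dist G y b.
Proof.
move=> hG yab; apply: le_ereal_inf_tmp => _ [p /= pb <-].
elim: p y yab pb => [|z p IHp] y yab /= pb.
  have -> : a = y.
    apply: val_inj; move: yab (ltn_ord b); rewrite pb /cyclic_rank.
    by rewrite leqnn subnn /=; case: (leqP b a); lia.
  by rewrite -pb (path_dist_le y [::]).
have [-> | ay] := eqVneq a y; first by rewrite -pb (path_dist_le y (z :: p)).
rewrite path_weight_cons.
have le_tail : path_weight G z p <= G y z + path_weight G z p.
  by rewrite leeDr // weight_ge0.
have [zy | zy] := eqVneq z y.
  by apply: le_trans le_tail; apply: IHp; rewrite ?zy // -?zy.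
have [Gyz | Gyz] := ltP (G y z) +oo; last first.
  move: Gyz; rewrite leye_eq => /eqP ->; rewrite addye ?leey //.
  by rewrite -ltNye; apply: lt_le_trans (path_weight_ge0 z p).
(* A finite edge that is not a loop ends at [ordS y]; since [a] is not [y], the ranks of [a] and [b]
   both drop by one. *)
have /(hG _ _)zS : y != z by rewrite eq_sym.
apply: le_trans le_tail; apply: IHp => //.
move: yab ay (ordS_val y) (ltn_ord a) (ltn_ord b).
rewrite -(zS.1 Gyz) /cyclic_rank -val_eqE /=.
by case: (leqP y a); case: (leqP y b); case: (leqP z a); case: (leqP z b); lia.
Qed.

End PathDistance.

(** * The winding cocycle *)

Section WindingCocycle.
Variables (R : realType) (n : nat) (G : network R 'I_n) (delta : R).
Hypothesis hG : consistently_oriented_cycle G.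
Hypothesis hmax : (\big[maxe/-oo]_(i < n) G i (ordS i) <= delta%:E)%E.
Hypothesis hmin : (delta%:E < \big[mine/+oo]_(ij : 'I_n * 'I_n | ij.1 != ij.2)
  maxe (path_dist G ij.1 ij.2) (path_dist G ij.2 ij.1))%E.

Let K := path_dowker G delta.

Lemma path_dist_ordS (i : 'I_n) : (path_dist G i (ordS i) <= delta%:E)%E.
Proof.
apply: le_trans (path_dist_weight G _ _) _; apply: le_trans hmax.
exact: (le_bigmax _ (fun i => G i (ordS i))).
Qed.

Lemma path_dist_antisym (i j : 'I_n) : i != j ->
  (path_dist G i j <= delta%:E)%E -> (delta%:E < path_dist G j i)%E.
Proof.
move=> neq le_ij.
have := lt_le_trans hmin (bigmin_le_cond (j := (i, j)) _ _ neq).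
by rewrite lt_max /= ltNge le_ij.
Qed.

(** A function of the bare set, as [sum_boundary] asks; the quantifiers recover the endpoints
    [a < b] of an edge. *)
Definition winding (A : {set 'I_n}) : R :=
  if [forall a in A, forall b in A,
    ((a < b)%N ==> (path_dist G a b <= delta%:E)%E)] then 0 else -1.

Lemma winding2 (a b : 'I_n) : (a < b)%N ->
  winding [set a; b] = if (path_dist G a b <= delta%:E)%E then 0 else -1.
Proof.
move=> ab; rewrite /winding; congr (if _ then _ else _).
apply/forall_inP/idP => [|ab_le].
  by move=> /(_ a (set21 _ _)) /forall_inP/(_ b (set22 _ _)); rewrite ab.
move=> x xA; apply/forall_inP => y yA; apply/implyP.
by move: xA yA; rewrite !inE => /orP[]/eqP-> /orP[]/eqP->;
  rewrite ?ltnn // ltnNge (ltnW ab).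
Qed.

(** The forward walk from [y] meets [y, ..., n - 1] and then [0, ..., y - 1]. If it meets [a] before
    [b], then [a < b] puts both in the same block; otherwise [b] is in the first block and [a] in
    the second. *)
Lemma winding_ball (y a b : 'I_n) : (a < b)%N ->
  (path_dist G y a <= delta%:E)%E -> (path_dist G y b <= delta%:E)%E ->
  winding [set a; b] = (b < y)%:R - (a < y)%:R.
Proof.
move=> ab ya yb; rewrite winding2 //.
have neq_ba : b != a by rewrite -val_eqE /= neq_ltn ab orbT.
have [an bn] := (ltn_ord a, ltn_ord b).
have [aby|] := boolP (cyclic_rank y a <= cyclic_rank y b)%N.
  rewrite (le_trans (path_dist_arc hG aby) yb).
  suff -> : (a < y)%N = (b < y)%N by rewrite subrr.
  by move: aby; rewrite /cyclic_rank; case: (leqP y a); case: (leqP y b); lia.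
rewrite -ltnNge => /[dup] bay /ltnW /(path_dist_arc hG) le_ba.
rewrite leNgt path_dist_antisym // ?(le_trans le_ba) //.
have [-> ->] : (b < y)%N = false /\ (a < y)%N = true.
  by move: bay; rewrite /cyclic_rank; case: (leqP y a); case: (leqP y b); lia.
by rewrite sub0r.
Qed.

Lemma winding_cocycle (c : chain R K 2) :
  \sum_(t : simplex K 1) winding (val t) * boundary_fun c t = 0.
Proof.
rewrite sum_boundary big1 // => s _.
have /andP[sK /eqP /set_ord_card3[x1 [x2 [x3 [x12 x23 sE]]]]] := valP s.
move: sK; rewrite sE alternating_sum3 // inE.
case/andP=> _ /existsP[y /forall_inP y_le].
have [y1 y2 y3] : [/\ (path_dist G y x1 <= delta%:E)%E,
    (path_dist G y x2 <= delta%:E)%E & (path_dist G y x3 <= delta%:E)%E].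
  by split; apply: y_le; rewrite !inE eqxx ?orbT.
have x13 := ltn_trans x12 x23.
rewrite !(@winding_ball y) //.
(* The three differences of indicators telescope. *)
by rewrite [X in _ * X](_ : _ = 0) ?mulr0 //; ring.
Qed.

(** * The fundamental cycle and its winding *)

Definition edge (i : 'I_n) : {set 'I_n} := [set i; ordS i].

(* The edge [{i, ordS i}] is oriented by the order of the naturals, which
   disagrees with the cyclic orientation only at [i = n - 1]. *)
Definition fundamental_chain : chain R K 1 :=
  [ffun s =>
    \sum_(i < n) (if (i < ordS i)%N then 1 else -1) * (val s == edge i)%:R].

Hypothesis n_gt1 : (1 < n)%N.

Lemma edge_simplex (i : 'I_n) : (edge i \in K) && (#|edge i| == 2).
Proof.
have neq := neq_ordS i n_gt1.
rewrite cards2 neq eqxx andbT inE -card_gt0 cards2 /=.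
(* The edge lies in the forward ball of [i]; that [i] itself does uses [0 <= delta], which follows
   from [path_dist_ordS]. *)
apply/existsP; exists i; apply/forall_inP => x; rewrite !inE => /orP[]/eqP->.
  apply: le_trans (path_dist_le G i [::]) _.
  rewrite /path_weight big_ord0; apply: le_trans (path_dist_ordS i).
  exact: path_dist_ge0.
exact: path_dist_ordS.
Qed.

Lemma sum_fundamental_chain (f : {set 'I_n} -> R) :
  \sum_(s : simplex K 1) fundamental_chain s * f (val s) =
  \sum_(i < n) (if (i < ordS i)%N then 1 else -1) * f (edge i).
Proof.
under eq_bigr => s _ do rewrite ffunE mulr_suml.
rewrite exchange_big; apply: eq_bigr => i _.
rewrite (bigD1 (Sub (edge i) (edge_simplex i) : simplex K 1)) //.
rewrite SubK eqxx mulr1.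
rewrite big1; first by rewrite SubK; exact: addr0.
move=> s; rewrite -val_eqE SubK => /negPf ->.
by rewrite mulr0 mul0r.
Qed.

Lemma boundary_fundamental_chain : boundary_fun fundamental_chain = 0.
Proof.
apply/ffunP => t; rewrite [RHS]ffunE.
(* The coefficient at [t] is the pairing with the indicator cochain of [t]. *)
transitivity (\sum_(t' : simplex K 0) (val t' == val t)%:R *
    boundary_fun fundamental_chain t').
  rewrite (bigD1 t) //= eqxx mul1r big1 ?addr0 // => t'.
  by rewrite -val_eqE => /negPf ->; rewrite mul0r.
rewrite (sum_boundary (fun A => (A == val t)%:R)).
rewrite (sum_fundamental_chain (fun A => \sum_(v in A)
  (-1) ^+ index v (enum A) * (A :\ v == val t)%:R)).
under eq_bigr => i _.
  have -> : (if (i < ordS i)%N then 1 else -1) * (\sum_(v in edge i)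
      (-1) ^+ index v (enum (edge i)) * (edge i :\ v == val t)%:R) =
      ([set ordS i] == val t)%:R - ([set i] == val t)%:R :> R.
    have [lt_i|gt_i|/val_inj/eqP] := ltngtP;
      last by rewrite (negPf (neq_ordS i n_gt1)).
    - by rewrite (alternating_sum2 (fun A => (A == val t)%:R)) // mul1r.
    - rewrite /edge finset.setUC.
      rewrite (alternating_sum2 (fun A => (A == val t)%:R)) //.
      by rewrite mulN1r opprB.
  over.
(* Since [ordS] is a permutation, the sums over heads and tails agree. *)
rewrite big_split /= sumrN [X in _ - X](reindex_inj (@ordS_inj n)) /=.
by rewrite subrr.
Qed.

(** Only the edge at [i = n - 1] counts: it runs from the larger vertex to the smaller, so its sign
    is [-1], and [path_dist_antisym] makes its winding [-1] too. *)
Lemma winding_edge (i : 'I_n) :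
  (if (i < ordS i)%N then 1 else -1) * winding (edge i) = (i.+1 == n)%:R.
Proof.
have neq := neq_ordS i n_gt1.
have iS := ordS_val i.
have [lt_i|gt_i|/val_inj/eqP] := ltngtP; last by rewrite (negPf neq).
  rewrite winding2 // path_dist_ordS mulr0.
  by case: eqP iS => // ->; lia.
rewrite /edge finset.setUC winding2 //.
rewrite leNgt path_dist_antisym ?path_dist_ordS // mulN1r opprK.
by case: eqP iS => //; lia.
Qed.

Lemma winding_fundamental_chain :
  \sum_(t : simplex K 1) winding (val t) * fundamental_chain t = 1.
Proof.
have n_gt0 : (n.-1 < n)%N by lia.
under eq_bigr => t _ do rewrite mulrC.
rewrite sum_fundamental_chain; under eq_bigr => i _ do rewrite winding_edge.
rewrite (bigD1 (Ordinal n_gt0)) //= prednK ?(ltnW n_gt1) // eqxx.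
rewrite big1 ?addr0 // => i; rewrite -val_eqE /= => i_neq.
suff /negPf -> : i.+1 != n by [].
lia.
Qed.

End WindingCocycle.

Theorem proposition15 (R : realType) (n : nat) (hn : (3 <= n)%N)
  (G : network R 'I_n) (hG : consistently_oriented_cycle G) (delta : R)
  (hmax : (\big[maxe/-oo]_(i < n) G i (ordS i) <= delta%:E)%E)
  (hmin : (delta%:E < \big[mine/+oo]_(ij : 'I_n * 'I_n | ij.1 != ij.2)
             maxe (path_dist G ij.1 ij.2) (path_dist G ij.2 ij.1))%E) :
  exists c : homology R (path_dowker G delta) 1, c != 0.
Proof.
have n_gt1 : (1 < n)%N by apply: ltn_trans hn.
apply: (homology_neq0 (phi := fun c : chain R (path_dowker G delta) 1 =>
  \sum_t winding G delta (val t) * c t) (z := fundamental_chain G delta)).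
- exact: winding_cocycle.
- exact: boundary_fundamental_chain.
by rewrite winding_fundamental_chain ?oner_neq0.
Qed.
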